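(* Let $n\ge 2$, let $(A,\cdot)$ be a commutative associative algebra over $\mathbb{K}$ and let $(L,[\cdot,\dots,\cdot],\varepsilon,\alpha)$ be an $n$-Hom-Lie color algebra. Then the tensor product $A\otimes L=\bigoplus_{g\in G}(A\otimes L)_g$ with $(A\otimes L)_g=A\otimes L_g$, equipped with the bracket $$[a_1\otimes x_1,\dots,a_n\otimes x_n]'=a_1\cdots a_n\otimes[x_1,\dots,x_n],$$ the even linear map $\alpha'(a\otimes x)=a\otimes\alpha(x)$, and the bicharacter $\varepsilon$ (so that for $a,b\in A$ and $x,y\in\mathcal{H}(L)$ the value of the bicharacter on the pair $a\otimes x$, $b\otimes y$ is $\varepsilon(x,y)$), is an $n$-Hom-Lie color algebra.
   Context: $G$ is an abelian group with neutral element $e$ (operation written $+$), $\mathbb{K}$ is a field of characteristic different from 2. A $G$-graded linear space is $V=\bigoplus_{a\in G}V_a$ over $\mathbb{K}$; $\mathcal{H}(V)$ is its set of homogeneous elements; a linear map $f:V\to V'$ is even if $f(V_a)\subseteq V'_a$ for all $a$. A (skew-symmetric) bicharacter is a map $\varepsilon:G\times G\to\mathbb{K}^*$ with $\varepsilon(a,b)\varepsilon(b,a)=1$, $\varepsilon(a,b+c)=\varepsilon(a,b)\varepsilon(a,c)$, $\varepsilon(a+b,c)=\varepsilon(a,c)\varepsilon(b,c)$. For homogeneous $x,y$ one writes $\varepsilon(x,y)$ for $\varepsilon(\deg x,\deg y)$, and sums of homogeneous elements inside $\varepsilon$ denote sums of their degrees. An $n$-Hom-Lie color algebra $(L,[\cdot,\dots,\cdot],\varepsilon,\alpha)$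 is a $G$-graded linear space $L$ with an $n$-linear map $[\cdot,\dots,\cdot]:L^n\to L$, a bicharacter $\varepsilon$ and an even linear map $\alpha:L\to L$ such that for all $x_i,y_j\in\mathcal{H}(L)$: (1) $[x_1,\dots,x_i,x_{i+1},\dots,x_n]=-\varepsilon(x_i,x_{i+1})[x_1,\dots,x_{i+1},x_i,\dots,x_n]$ for $1\le i\le n-1$; (2) $[\alpha(x_1),\dots,\alpha(x_{n-1}),[y_1,\dots,y_n]]=\sum_{i=1}^n\varepsilon(X,Y_i)[\alpha(y_1),\dots,\alpha(y_{i-1}),[x_1,\dots,x_{n-1},y_i],\alpha(y_{i+1}),\dots,\alpha(y_n)]$, where $X=x_1+\dots+x_{n-1}$, $Y_i=y_1+\dots+y_{i-1}$ (sums of degrees, $Y_1=e$). *)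

(* Defs.v *)
From HB Require Import structures.
From mathcomp Require Import all_boot all_algebra perm.
From mathcomp Require Import boolp classical_sets.
From mathcomp.multinomials Require Import freeg.

Set Implicit Arguments.
Unset Strict Implicit.
Unset Printing Implicit Defensive.

Import GRing.Theory.
Local Open Scope ring_scope.
Local Open Scope quotient_scope.

Section Tensor.
Variables (K : fieldType) (A L : lmodType K).

Local Notation free := {freeg (A * L)%type / K}.
Local Notation gen a x := (<< (a, x) >> : free).

(* The submodule of the free module on A * L spanned by the bilinearity
   relations. *)
Inductive tensor_rel : free -> Prop :=
| tensor_rel0 : tensor_rel 0
| tensor_relP c r s : tensor_rel r -> tensor_rel s -> tensor_rel (c *: r + s)
| tensor_rell c a b x :
    tensor_rel (gen (c *: a + b) x - (c *: gen a x + gen b x))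
| tensor_relr c a x y :
    tensor_rel (gen a (c *: x + y) - (c *: gen a x + gen a y)).

Definition tensor_relb : {pred free} := [pred r | `[< tensor_rel r >]].

Lemma tensor_relZ c r : tensor_rel r -> tensor_rel (c *: r).
Proof.
move=> Rr; rewrite -[_ *: _]addr0; apply: tensor_relP => //.
exact: tensor_rel0.
Qed.

Lemma tensor_relb_zmod : zmod_closed tensor_relb.
Proof.
split=> [|r s /asboolP Rr /asboolP Rs]; apply/asboolP; first exact: tensor_rel0.
rewrite -[r]scale1r -[- s]scaleN1r; apply: tensor_relP => //.
exact: tensor_relZ.
Qed.
HB.instance Definition _ :=
  GRing.isZmodClosed.Build free tensor_relb tensor_relb_zmod.

(* The tensor product A (x) L over K. *)
Definition tensor : Type := Quotient.quot tensor_relb.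
HB.instance Definition _ := GRing.Zmodule.on tensor.
HB.instance Definition _ := Quotient.on tensor.

Definition tens_class (r : free) : tensor := \pi_(Quotient.quot tensor_relb) r.

Lemma tens_classP r s : tens_class r = tens_class s <-> tensor_rel (r - s).
Proof.
split=> [/eqP|Rrs]; first by rewrite /tens_class -Quotient.idealrBE => /asboolP.
by apply/eqP; rewrite /tens_class -Quotient.idealrBE; apply/asboolP.
Qed.

Lemma tens_classK (t : tensor) : tens_class (repr t) = t.
Proof. exact: reprK. Qed.

Lemma tens_classD r s : tens_class (r + s) = tens_class r + tens_class s.
Proof. exact: Quotient.pi_add. Qed.

Definition tensor_scale (c : K) (t : tensor) : tensor :=
  tens_class (c *: repr t).

Lemma tens_classZ c r : tens_class (c *: r) = tensor_scale c (tens_class r).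
Proof.
apply/tens_classP; rewrite -scalerBr; apply: tensor_relZ.
by apply/tens_classP; rewrite tens_classK.
Qed.

Lemma tensor_scaleA c d t :
  tensor_scale c (tensor_scale d t) = tensor_scale (c * d) t.
Proof. by rewrite -[t]tens_classK -!tens_classZ scalerA. Qed.

Lemma tensor_scale1 : left_id 1 tensor_scale.
Proof. by move=> t; rewrite -[t]tens_classK -!tens_classZ scale1r. Qed.

Lemma tensor_scaleDr : right_distributive tensor_scale +%R.
Proof.
move=> c t u; rewrite -[t]tens_classK -[u]tens_classK.
by rewrite -tens_classD -!tens_classZ -tens_classD scalerDr.
Qed.

Lemma tensor_scaleDl t : {morph tensor_scale^~ t : c d / c + d}.
Proof.
by move=> c d; rewrite -[t]tens_classK -!tens_classZ -tens_classD scalerDl.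
Qed.

HB.instance Definition _ := GRing.Zmodule_isLmodule.Build K tensor
  tensor_scaleA tensor_scale1 tensor_scaleDr tensor_scaleDl.

Lemma tens_class_linear : linear tens_class.
Proof. by move=> c r s; rewrite tens_classD tens_classZ. Qed.
HB.instance Definition _ :=
  GRing.isLinear.Build K free tensor _ tens_class tens_class_linear.

Definition tens (a : A) (x : L) : tensor := tens_class (gen a x).

Lemma tens_bilinear : bilinear_for *:%R *:%R tens.
Proof.
split=> [x c a b|a c x y]; rewrite /tens /= -linearZ -raddfD; apply/tens_classP.
  exact: tensor_rell.
exact: tensor_relr.
Qed.
HB.instance Definition _ :=
  bilinear_isBilinear.Build K A L tensor *:%R *:%R tens tens_bilinear.

Lemma tens_span (t : tensor) :
  exists s : seq (A * L), t = \sum_(p <- s) tens p.1 p.2.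
Proof.
rewrite -[t]tens_classK; set r := repr t.
exists [seq (coeff p r *: p.1, p.2) | p <- dom r].
rewrite big_map -[in LHS](freeg_sumE r) raddf_sum.
apply: eq_bigr => -[a x] _ /=.
rewrite linearZl_LR /= -linearZ /=; congr tens_class.
by apply/eqP/freeg_eqP => q; rewrite coeffZ !coeffU mul1r.
Qed.

Lemma tensor_universal (M : lmodType K) (f : {bilinear A -> L -> M}) :
  exists h : {linear tensor -> M},
    (forall a x, h (tens a x) = f a x) /\
    (forall h' : {linear tensor -> M},
       (forall a x, h' (tens a x) = f a x) -> h' =1 h).
Proof.
pose F (r : free) : M := fglift (fun p : A * L => f p.1 p.2) r.
have FB : {morph F : r s / r - s} := @lift_is_additive _ _ _ _.
have FU c p : F << c *g p >> = c *: f p.1 p.2 by rewrite /F liftU.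
pose Fa : {additive free -> M} :=
  HB.pack F (GRing.isZmodMorphism.Build _ _ F FB).
have Fsum (s : seq (A * L)) (r : A * L -> free) :
    F (\sum_(p <- s) r p) = \sum_(p <- s) F (r p) := raddf_sum Fa _ _ _.
have FZ c r : F (c *: r) = c *: F r.
  have -> : c *: r = \sum_(p <- dom r) << c * coeff p r *g p >>.
    rewrite -{1}(freeg_sumE r) scaler_sumr; apply: eq_bigr => p _.
    by apply/eqP/freeg_eqP => q; rewrite coeffZ !coeffU mulrA.
  rewrite -[in RHS](freeg_sumE r) !Fsum scaler_sumr.
  by apply: eq_bigr => p _; rewrite !FU scalerA.
have Flin : linear F.
  by move=> c r s; rewrite -FZ; exact: (raddfD Fa).
have Frel r : tensor_rel r -> F r = 0.
  elim=> {r} [|c r s _ r0 _ s0|c a b x|c a x y].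
  - exact: (raddf0 Fa).
  - by rewrite Flin r0 s0 scaler0 addr0.
  - by rewrite FB Flin !FU !scale1r linearPl subrr.
  - by rewrite FB Flin !FU !scale1r linearPr subrr.
pose h (t : tensor) := F (repr t).
have hE r : h (tens_class r) = F r.
  apply/eqP; rewrite -subr_eq0 -FB; apply/eqP/Frel.
  by apply/tens_classP; rewrite tens_classK.
have hlin : linear h.
  move=> c t u; rewrite -[t]tens_classK -[u]tens_classK -linearP !hE.
  exact: Flin.
pose hl : {linear tensor -> M} :=
  HB.pack h (GRing.isLinear.Build K tensor M _ h hlin).
have hlE a x : hl (tens a x) = f a x by rewrite /= hE FU scale1r.
exists hl; split=> // h' h'E t; have [s ->] := tens_span t.
rewrite !raddf_sum; apply: eq_bigr => p _.
exact: etrans (h'E _ _) (esym (hlE _ _)).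
Qed.

End Tensor.

Section ColorAlgebra.
Variables (G : zmodType) (K : fieldType).

Definition is_subspace (V : lmodType K) (S : set V) : Prop :=
  S 0 /\ forall c u v, S u -> S v -> S (c *: u + v).

(* V is the internal direct sum of the subspaces Vg g. *)
Record is_grading (V : lmodType K) (Vg : G -> set V) : Prop := IsGrading {
  grading_subspace : forall g, is_subspace (Vg g);
  grading_sum : forall v, exists (s : seq G) (c : G -> V),
    [/\ uniq s, forall g, Vg g (c g) & v = \sum_(g <- s) c g];
  grading_direct : forall (s : seq G) (c : G -> V),
    uniq s -> (forall g, Vg g (c g)) -> \sum_(g <- s) c g = 0 ->
    forall g, g \in s -> c g = 0 }.

Definition even_map (V W : lmodType K) (Vg : G -> set V) (Wg : G -> set W)
  (f : V -> W) : Prop := forall g v, Vg g v -> Wg g (f v).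

Record is_bicharacter (eps : G -> G -> K) : Prop := IsBicharacter {
  bichar_neq0 : forall a b, eps a b != 0;
  bichar_skew : forall a b, eps a b * eps b a = 1;
  bicharDr : forall a b c, eps a (b + c) = eps a b * eps a c;
  bicharDl : forall a b c, eps (a + b) c = eps a c * eps b c }.

Section Multilinear.
Variables (n : nat) (V W : lmodType K).

Definition upd (x : {ffun 'I_n -> V}) (i : 'I_n) (u : V) : {ffun 'I_n -> V} :=
  [ffun j => if j == i then u else x j].

Definition multilinear (f : {ffun 'I_n -> V} -> W) : Prop :=
  forall x i c u v,
    f (upd x i (c *: u + v)) = c *: f (upd x i u) + f (upd x i v).
End Multilinear.

(* The n-tuple (x_1, ..., x_(n-1), z). *)
Definition append_last (n : nat) (T : Type) (x : 'I_n.-1 -> T) (z : T) :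
    {ffun 'I_n -> T} :=
  [ffun i : 'I_n => if insub (i : nat) is Some j then x j else z].

(* Axioms quantify over homogeneous elements together with their degrees;
   0 is homogeneous of every degree. *)
Record is_nHomLieColor (n : nat) (L : lmodType K) (Lg : G -> set L)
    (br : {ffun 'I_n -> L} -> L) (eps : G -> G -> K)
    (alpha : {linear L -> L}) : Prop := IsNHomLieColor {
  nhlc_grading : is_grading Lg;
  nhlc_multilinear : multilinear br;
  nhlc_bicharacter : is_bicharacter eps;
  nhlc_even : even_map Lg Lg alpha;
  nhlc_skew : forall (x : {ffun 'I_n -> L}) (d : 'I_n -> G),
    (forall i, Lg (d i) (x i)) ->
    forall i j : 'I_n, j = i.+1 :> nat ->
    br x = - (eps (d i) (d j) *: br [ffun k => x (tperm i j k)]);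
  nhlc_jacobi : forall (x : 'I_n.-1 -> L) (dx : 'I_n.-1 -> G)
      (y : {ffun 'I_n -> L}) (dy : 'I_n -> G),
    (forall i, Lg (dx i) (x i)) -> (forall i, Lg (dy i) (y i)) ->
    br (append_last (alpha \o x) (br y)) =
    \sum_(i < n)
      eps (\sum_j dx j) (\sum_(j < n | (j < i)%N) dy j) *:
      br (upd [ffun j => alpha (y j)] i (br (append_last x (y i)))) }.

(* a_1 a_2 ... a_n in an algebra that need not be unital; the value 0 at n = 0
   is a dummy. *)
Definition nprod (n : nat) (A : lmodType K) (mul : A -> A -> A)
    (a : 'I_n -> A) : A :=
  if [seq a i | i <- enum 'I_n] is b :: s then foldl mul b s else 0.

(* The subspace A (x) Lg g of A (x) L. *)
Definition tensor_grading (A L : lmodType K) (Lg : G -> set L) (g : G) :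
    set (tensor A L) :=
  fun t => exists s : seq (A * L),
    (forall p, p \in s -> Lg g p.2) /\ t = \sum_(p <- s) tens p.1 p.2.

End ColorAlgebra.

(* Main.v *)
(** A multilinear map on A (x) L is determined by its values on pure tensors, so
    each axiom reduces to pure tensors of homogeneous elements, where it is the
    axiom of L times an identity between products in the commutative algebra A.
    The grading is direct because the projections of L onto its homogeneous
    components extend to A (x) L. *)

Require Import Defs.
From HB Require Import structures.
From mathcomp Require Import all_boot all_algebra perm.
From mathcomp Require Import boolp classical_sets.

Set Implicit Arguments.
Unset Strict Implicit.
Unset Printing Implicit Defensive.

Import GRing.Theory.
Local Open Scope ring_scope.

(** * Changing one slot of a tuple *)

Section Update.
Variables (K : fieldType) (n : nat) (V : lmodType K).
Implicit Types (x : {ffun 'I_n -> V}) (u v : V).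

Lemma upd_same x i u : upd x i u i = u.
Proof. by rewrite ffunE eqxx. Qed.

Lemma upd_other x i u j : j != i -> upd x i u j = x j.
Proof. by rewrite ffunE => /negPf->. Qed.

Lemma upd_upd x i u v : upd (upd x i u) i v = upd x i v.
Proof. by apply/ffunP=> j; rewrite !ffunE; case: eqP. Qed.

Lemma upd_id x i : upd x i (x i) = x.
Proof. by apply/ffunP=> j; rewrite !ffunE; case: eqP => [->|]. Qed.

Lemma updC x i j u v : i != j -> upd (upd x i u) j v = upd (upd x j v) i u.
Proof.
move=> ij; apply/ffunP=> k; rewrite !ffunE.
by case: (k =P j) => [->|//]; rewrite eq_sym (negPf ij).
Qed.

End Update.

(** * Multilinear maps and their values on spanning sets *)

Section Multilinear.
Variables (K : fieldType) (n : nat) (V W : lmodType K).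
Implicit Types f g : {ffun 'I_n -> V} -> W.

Lemma multilinear_scale c f : multilinear f -> multilinear (fun x => c *: f x).
Proof.
by move=> fM x i d u v; rewrite fM scalerDr !scalerA [c * d]mulrC.
Qed.

Lemma multilinear_opp f : multilinear f -> multilinear (fun x => - f x).
Proof. by move=> fM x i d u v; rewrite fM opprD scalerN. Qed.

Lemma multilinear_sum (I : Type) (r : seq I) (P : pred I)
    (f : I -> {ffun 'I_n -> V} -> W) :
  (forall i, multilinear (f i)) ->
  multilinear (fun x => \sum_(i <- r | P i) f i x).
Proof.
move=> fM x i c u v; rewrite scaler_sumr -big_split.
by apply: eq_bigr => j _; apply: fM.
Qed.

Lemma multilinear_perm (s : 'S_n) f :
  multilinear f -> multilinear (fun x => f [ffun k => x (s k)]).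
Proof.
move=> fM x i c u v.
(* Slot [i] of [x] is read at the position that [s] sends to [i]. *)
have E w : [ffun k => upd x i w (s k)] =
    upd [ffun k => x (s k)] ((s^-1)%g i) w.
  by apply/ffunP=> k; rewrite !ffunE (canF_eq (permK s)).
by rewrite !E fM.
Qed.

Lemma multilinear0 f x i : multilinear f -> f (upd x i 0) = 0.
Proof.
by move=> fM; have := fM x i (-1) 0 0; rewrite scaler0 addr0 scaleN1r addNr.
Qed.

Lemma multilinear_upd_sum f x i (I : Type) (r : seq I) (F : I -> V) :
  multilinear f ->
  f (upd x i (\sum_(k <- r) F k)) = \sum_(k <- r) f (upd x i (F k)).
Proof.
move=> fM; elim: r => [|k r IH]; first by rewrite !big_nil multilinear0.
by rewrite !big_cons -[F k]scale1r fM !scale1r IH.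
Qed.

(** The sums are expanded one slot at a time. [Q] depends on the slot because degrees will vary from
    slot to slot. *)
Lemma eq_multilinear_span f g (Q : 'I_n -> V -> Prop) :
  multilinear f -> multilinear g ->
  (forall x : {ffun 'I_n -> V}, (forall i, Q i (x i)) -> f x = g x) ->
  forall x : {ffun 'I_n -> V}, (forall i, exists s : seq V,
      (forall u, u \in s -> Q i u) /\ x i = \sum_(u <- s) u) ->
    f x = g x.
Proof.
move=> fM gM fg x xS.
(* Slots below [k] hold the given sums, the others hold elements of [Q]. Passing from [k] to [k.+1]
   expands the sum in slot [k]. *)
suff H k : forall y : {ffun 'I_n -> V},
    (forall i : 'I_n, (k <= i)%N -> Q i (y i)) ->
    (forall i : 'I_n, (i < k)%N -> y i = x i) -> f y = g y.
  by apply: (H n) => // i; rewrite leqNgt ltn_ord.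
elim: k => [|k IH] y yQ yx; first by apply: fg => i; apply: yQ.
have [kn|nk] := ltnP k n; last first.
  apply: IH => i; last by move=> ik; apply: yx; apply: leqW.
  by rewrite leqNgt (leq_trans (ltn_ord i) nk).
pose i0 := Ordinal kn.
have [s [sQ xE]] := xS i0.
rewrite -[y](upd_id _ i0) yx // xE !multilinear_upd_sum //.
apply: eq_big_seq => u us; apply: IH => i ki; last first.
  by rewrite upd_other ?yx ?ltnS 1?ltnW // -val_eqE neq_ltn ki.
have [->|ne] := eqVneq i i0; first by rewrite upd_same; apply: sQ.
rewrite upd_other //; apply: yQ.
by rewrite ltn_neqAle ki andbT eq_sym.
Qed.

End Multilinear.

(** * Linear and multilinear maps out of the tensor product *)

Section TensorMaps.
Variables (K : fieldType) (A L : lmodType K).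

(** The universal property for maps whose bilinearity is only a hypothesis, such as the slot maps of
    a larger function. *)
Lemma tensor_lift (M : lmodType K) (f : A -> L -> M) :
  bilinear_for *:%R *:%R f ->
  exists h : {linear tensor A L -> M}, forall a x, h (tens a x) = f a x.
Proof.
move=> fB.
pose F : {bilinear A -> L -> M} :=
  HB.pack f (bilinear_isBilinear.Build K A L M *:%R *:%R f fB).
by have [h [hE _]] := tensor_universal F; exists h.
Qed.

(** This is the identity of [A] tensored with [f]; it yields both [alpha'] and the extended
    projections. *)
Lemma tensor_map (L' : lmodType K) (f : {linear L -> L'}) :
  exists h : {linear tensor A L -> tensor A L'},
    forall a x, h (tens a x) = tens a (f x).
Proof.
apply: (@tensor_lift (tensor A L') (fun a x => tens a (f x))); split=> [x|a] c u v /=.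
  by rewrite linearPl.
by rewrite linearP linearPr.
Qed.

(* The slots are moved one at a time from A * L to tensor A L: in the inner
   statement the slots below k of Psi are read in t and the others in p. *)
Lemma multilinear_tensor_lift (n : nat) (M : lmodType K)
    (f : {ffun 'I_n -> A * L} -> M) :
  (forall p i, bilinear_for *:%R *:%R (fun a x => f (upd p i (a, x)))) ->
  exists F : {ffun 'I_n -> tensor A L} -> M, multilinear F /\
    forall p : {ffun 'I_n -> A * L}, F [ffun i => tens (p i).1 (p i).2] = f p.
Proof.
move=> fB.
suff [Psi [PsiM _ PsiE]] : exists Psi :
    {ffun 'I_n -> tensor A L} -> {ffun 'I_n -> A * L} -> M,
  [/\ forall t p (i : 'I_n) c u v, (i < n)%N ->
        Psi (upd t i (c *: u + v)) p =
        c *: Psi (upd t i u) p + Psi (upd t i v) p,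
      forall t p (i : 'I_n), (n <= i)%N ->
        bilinear_for *:%R *:%R (fun a x => Psi t (upd p i (a, x))) &
      forall (t : {ffun 'I_n -> tensor A L}) (p q : {ffun 'I_n -> A * L}),
        (forall i : 'I_n, (i < n)%N -> t i = tens (q i).1 (q i).2) ->
        (forall i : 'I_n, (n <= i)%N -> p i = q i) -> Psi t p = f q].
  (* Once every slot is read in [t], the second argument is a dummy, set to 0. *)
  exists (Psi ^~ 0); split=> [t i c u v|p]; first by apply: PsiM.
  by apply: PsiE => i; rewrite ?ffunE // leqNgt ltn_ord.
suff H k : (k <= n)%N -> exists Psi :
    {ffun 'I_n -> tensor A L} -> {ffun 'I_n -> A * L} -> M,
  [/\ forall t p (i : 'I_n) c u v, (i < k)%N ->
        Psi (upd t i (c *: u + v)) p =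
        c *: Psi (upd t i u) p + Psi (upd t i v) p,
      forall t p (i : 'I_n), (k <= i)%N ->
        bilinear_for *:%R *:%R (fun a x => Psi t (upd p i (a, x))) &
      forall (t : {ffun 'I_n -> tensor A L}) (p q : {ffun 'I_n -> A * L}),
        (forall i : 'I_n, (i < k)%N -> t i = tens (q i).1 (q i).2) ->
        (forall i : 'I_n, (k <= i)%N -> p i = q i) -> Psi t p = f q].
  exact: H.
elim: k => [_|k IH kn].
  exists (fun _ p => f p); split=> // t p q _ pq.
  by congr f; apply/ffunP => i; apply: pq.
have [Psi [PsiM PsiB PsiE]] := IH (ltnW kn).
pose i0 := Ordinal kn.
have /choice[h hE] : forall tp : {ffun 'I_n -> tensor A L} * {ffun 'I_n -> A * L},
    exists h : {linear tensor A L -> M},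
    forall a x, h (tens a x) = Psi tp.1 (upd tp.2 i0 (a, x)).
  by move=> [t p]; apply: tensor_lift; apply: PsiB.
(* The maps [h tp] are chosen independently, so only their values on pure tensors can be compared;
   these span, which carries linearity in the remaining slots over to [h]. *)
have h_ext c tp1 tp2 tp3 :
    (forall a x, h tp1 (tens a x) = c *: h tp2 (tens a x) + h tp3 (tens a x)) ->
    forall t, h tp1 t = c *: h tp2 t + h tp3 t.
  move=> E t; have [s ->] := tens_span t.
  rewrite !raddf_sum -big_split /=.
  by apply: eq_bigr => r _; apply: E.
(* Slot [i0] is reset to 0 in the index of [h], so the linear map does not depend on [t i0], and
   linearity in that slot is that of [h]. *)
exists (fun t p => h (upd t i0 0, p) (t i0)); split.
- move=> t p i c u v; rewrite ltnS leq_eqVlt => /predU1P[ik|ik].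
    have -> : i = i0 by apply: val_inj.
    by rewrite !upd_upd !upd_same linearP.
  have ne : i != i0 by rewrite -val_eqE neq_ltn ik.
  rewrite !(updC _ _ _ ne) !(@upd_other _ _ _ _ i _ i0) 1?eq_sym //.
  by apply: h_ext => a x; rewrite !hE /= PsiM.
- move=> t p i ki; have ne : i != i0 by rewrite -val_eqE neq_ltn ki orbT.
  split=> [x|a] c u v /=; apply: h_ext => b y; rewrite !hE /= !(updC _ _ _ ne).
    exact: (PsiB _ _ i (ltnW ki)).1.
  exact: (PsiB _ _ i (ltnW ki)).2.
- move=> t p q tq pq; rewrite tq // hE /=; apply: PsiE => i ik.
    by rewrite upd_other ?tq ?ltnS 1?ltnW // -val_eqE neq_ltn ik.
  have [->|ne] := eqVneq i i0; first by rewrite upd_same; case: (q i0).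
  by rewrite upd_other // pq // ltn_neqAle ik eq_sym andbT.
Qed.

End TensorMaps.

(** * Gradings and projections onto homogeneous components *)

Lemma big_uniq_sub (G : eqType) (V : nmodType) (s s' : seq G) (F : G -> V) :
  uniq s -> uniq s' -> {subset s <= s'} ->
  \sum_(g <- s') (if g \in s then F g else 0) = \sum_(g <- s) F g.
Proof.
move=> us us' ss'; rewrite -big_mkcond -big_filter; apply: perm_big.
apply: uniq_perm; rewrite ?filter_uniq // => g; rewrite mem_filter.
by case gs: (g \in s); rewrite //= ss'.
Qed.

Section Gradings.
Variables (G : zmodType) (K : fieldType).

Section Subspace.
Variables (V : lmodType K) (S : set V).
Hypothesis S_sub : is_subspace S.

Lemma subspaceD u v : S u -> S v -> S (u + v).
Proof. by move=> Su Sv; rewrite -[u]scale1r; apply: S_sub.2. Qed.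

Lemma subspace_if (b : bool) u : S u -> S (if b then u else 0).
Proof. by case: b => // _; apply: S_sub.1. Qed.

End Subspace.

(** The relation [P v w], that [w] is the [h]-component in some decomposition of [v], respects
    linear combinations, so directness at 0 makes it single-valued. Decompositions exist, and choice
    turns [P] into a linear map. *)
Lemma grading_proj (V : lmodType K) (Vg : G -> set V) (h : G) :
  is_grading Vg -> exists p : {linear V -> V},
    (forall v, Vg h v -> p v = v) /\
    (forall g v, g != h -> Vg g v -> p v = 0).
Proof.
move=> [Vsub Vsum Vdir].
(* Without [h \in s] the value [c h] would be unconstrained within [Vg h]. *)
pose P v w := exists (s : seq G) (c : G -> V),
  [/\ uniq s, h \in s, forall g, Vg g (c g), v = \sum_(g <- s) c g & w = c h].
have P0 w : P 0 w -> w = 0.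
  by move=> [s [c [us hs cV /esym c0 ->]]]; apply: Vdir us cV c0 h hs.
have PP k v w v' w' : P v w -> P v' w' -> P (k *: v + v') (k *: w + w').
  move=> [s [c [us hs cV -> ->]]] [s' [c' [us' hs' cV' -> ->]]].
  (* Both decompositions are put on a common index list, with 0 for absent components. *)
  exists (undup (s ++ s')), (fun g => k *: (if g \in s then c g else 0) +
    (if g \in s' then c' g else 0)); split.
  - exact: undup_uniq.
  - by rewrite mem_undup mem_cat hs.
  - move=> g; by apply: (Vsub g).2; apply: subspace_if.
  - rewrite big_split /= -scaler_sumr !big_uniq_sub ?undup_uniq //.
      by move=> g gs; rewrite mem_undup mem_cat gs orbT.
    by move=> g gs; rewrite mem_undup mem_cat gs.
  - by rewrite hs hs'.
have Puniq v w w' : P v w -> P v w' -> w = w'.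
  move=> Pw Pw'; apply/esym/subr0_eq/P0.
  by have := PP (-1) _ _ _ _ Pw Pw'; rewrite !scaleN1r addNr addrC.
have PV g v : Vg g v -> P v (if g == h then v else 0).
  (* The index [h] is added to the list to meet [P]; [undup] covers the case [g = h]. *)
  move=> gv; exists (undup [:: g; h]), (fun k => if k == g then v else 0).
  split.
  - exact: undup_uniq.
  - by rewrite mem_undup !inE eqxx orbT.
  - by move=> k; case: eqP => [->|_] //; apply: (Vsub k).1.
  - rewrite -big_mkcond -big_filter (perm_big [:: g]) ?big_seq1 //.
    apply: uniq_perm => [|//|k]; first by rewrite filter_uniq ?undup_uniq.
    by rewrite mem_filter mem_undup !inE; case: eqP.
  - by rewrite eq_sym.
have /choice[p pP] : forall v, exists w, P v w.
  move=> v; have [s [c [us cV ->]]] := Vsum v.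
  exists (if h \in s then c h else 0), (undup (h :: s)),
    (fun g => if g \in s then c g else 0); split=> //.
  - exact: undup_uniq.
  - by rewrite mem_undup mem_head.
  - by move=> g; apply: subspace_if.
  - rewrite big_uniq_sub ?undup_uniq // => g gs.
    by rewrite mem_undup inE gs orbT.
have p_lin : linear p by move=> k v w; apply: Puniq (pP _) (PP _ _ _ _ _ _ _).
pose pl : {linear V -> V} := HB.pack p (GRing.isLinear.Build K V V _ p p_lin).
exists pl; split=> [v /PV|g v gh /PV]; rewrite ?eqxx ?(negPf gh);
  exact: (Puniq _ _ _ (pP v)).
Qed.

(** * The grading of [tensor A L] *)

Section TensorGrading.
Variables (A L : lmodType K) (Lg : G -> set L).

Lemma tensor_grading_subspace g :
  is_subspace (Lg g) -> is_subspace (tensor_grading (A := A) Lg g).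
Proof.
move=> Lsub; split; first by exists [::]; rewrite big_nil.
move=> c _ _ [s [sg ->]] [s' [sg' ->]].
exists ([seq (c *: p.1, p.2) | p <- s] ++ s'); split.
  by move=> p; rewrite mem_cat => /orP[/mapP[q qs ->]|]; [exact: (sg q) | exact: sg'].
rewrite big_cat big_map scaler_sumr /=; congr (_ + _).
by apply: eq_bigr => p _; rewrite linearZl_LR.
Qed.

Lemma tens_homogeneous g (a : A) x :
  Lg g x -> tensor_grading Lg g (tens a x).
Proof.
move=> gx; exists [:: (a, x)]; rewrite big_seq1; split=> // p.
by rewrite inE => /eqP->.
Qed.

Lemma tensor_is_grading : is_grading Lg -> is_grading (tensor_grading (A := A) Lg).
Proof.
move=> Lgr; have [Lsub Lsum _] := Lgr.
have Tsub g := @tensor_grading_subspace g (Lsub g).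
split=> [//|t|s c us cT c0 h hs].
  (* Existence: each pure tensor is split by decomposing its factor in [L]. *)
  have [r ->] := tens_span t; elim: r => [|[a x] r [s [c [us cT E]]]].
    by exists [::], (fun=> 0); split=> // [g|]; rewrite ?big_nil //; apply: (Tsub g).1.
  have [s' [c' [us' cL ->]]] := Lsum x.
  exists (undup (s' ++ s)), (fun g => (if g \in s' then tens a (c' g) else 0) +
    (if g \in s then c g else 0)); split.
  - exact: undup_uniq.
  - move=> g; apply: subspaceD => //; apply: subspace_if => //.
    exact: tens_homogeneous.
  - rewrite big_cons big_split /= E linear_sumr !big_uniq_sub ?undup_uniq //.
      by move=> g gs; rewrite mem_undup mem_cat gs orbT.
    by move=> g gs; rewrite mem_undup mem_cat gs.
(* Directness: [q] fixes the component of degree [h] and kills the others, so applying it to the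
   vanishing sum leaves [c h = 0]. *)
have [p [p_id p_0]] := grading_proj h Lgr.
have [q qE] := tensor_map A p.
have q_id : q (c h) = c h.
  have [r [rL ->]] := cT h; rewrite raddf_sum; apply: eq_big_seq => u ur.
  by rewrite /= qE p_id //; apply: rL.
have q_0 g : g != h -> q (c g) = 0.
  move=> gh; have [r [rL ->]] := cT g; rewrite raddf_sum big_seq big1 // => u ur.
  by rewrite /= qE (p_0 g) ?linear0r //; apply: rL.
move/(congr1 q): c0; rewrite raddf0 raddf_sum (bigD1_seq h) //= big1 ?addr0 ?q_id //.
Qed.

End TensorGrading.
End Gradings.

(** * Products of tuples in the commutative algebra *)

Section ProductOfTuple.
Variables (K : fieldType) (A : lmodType K) (mul : {bilinear A -> A -> A}).
Hypotheses (mulA : associative mul) (mulC : commutative mul).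

(* As A need not have a unit, products over index sets are taken in option A,
   with None as the empty product. *)
Local Notation opA := (oAC mulA mulC).

(** Opens the way to reindexing and extracting factors. At [n = 0] it would fail: the left side is
    [Some 0], the right side [None]. *)
Lemma nprod_big (n : nat) (a : 'I_n -> A) : (0 < n)%N ->
  Some (nprod mul a) = \big[opA/None]_i Some (a i).
Proof.
move=> n_gt0; rewrite -big_enum -(big_map a predT Some) /nprod.
have: size [seq a i | i <- enum 'I_n] != 0 by rewrite size_map size_enum_ord -lt0n.
case: [seq a i | i <- enum 'I_n] => // b s _.
(* [foldl] brackets to the left and the big operator to the right; associativity reconciles them. *)
elim: s b => [|c s IH] b /=; first by rewrite big_seq1.
by rewrite IH !big_cons Monoid.mulmA.
Qed.

Lemma nprod_perm (n : nat) (s : 'S_n) (a : 'I_n -> A) : (0 < n)%N ->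
  nprod mul (a \o s) = nprod mul a.
Proof.
move=> n_gt0; apply: Some_inj; rewrite !nprod_big //.
by rewrite [RHS](reindex_inj (@perm_inj _ s)).
Qed.

Lemma nprod_upd (n : nat) (a : {ffun 'I_n -> A}) (i : 'I_n) u :
  Some (nprod mul (upd a i u)) =
  opA (Some u) (\big[opA/None]_(j | j != i) Some (a j)).
Proof.
rewrite nprod_big; last exact: leq_ltn_trans (ltn_ord i).
rewrite (bigD1 i) //= upd_same; congr (opA _ _).
by apply: eq_bigr => j ji; rewrite upd_other.
Qed.

Lemma nprod_multilinear n : multilinear (fun a : {ffun 'I_n -> A} => nprod mul a).
Proof.
move=> a i c u v; apply: Some_inj; rewrite nprod_upd.
have := nprod_upd a i u; have := nprod_upd a i v.
(* The product of the other factors is [None] when slot [i] is the only one. *)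
case: (\big[_/_]_(j | _) _) => [b|] /Some_inj-> /Some_inj->.
  by rewrite oACE linearPl.
by [].
Qed.

Lemma nprod_append_last (n : nat) (a : 'I_n.-1 -> A) z : (0 < n)%N ->
  Some (nprod mul (append_last a z)) = opA (\big[opA/None]_i Some (a i)) (Some z).
Proof.
case: n a => // n a _; rewrite nprod_big // big_ord_recr /=; congr (opA _ _).
  apply: eq_bigr => i _; rewrite ffunE.
  by case: insubP => [j _ ji|]; [congr (Some (a _)); apply: val_inj | rewrite /= ltn_ord].
by rewrite ffunE insubF ?ltnn.
Qed.

(** Both sides multiply all entries of [a] and [b] once. Hence every term of the Jacobi identity
    carries the same coefficient in [A]. *)
Lemma nprod_jacobi (n : nat) (a : 'I_n.-1 -> A) (b : {ffun 'I_n -> A}) (i : 'I_n) :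
  nprod mul (append_last a (nprod mul b)) =
  nprod mul (upd b i (nprod mul (append_last a (b i)))).
Proof.
have n_gt0 : (0 < n)%N by apply: leq_ltn_trans (ltn_ord i).
apply: Some_inj; rewrite nprod_upd !nprod_append_last // nprod_big //.
by rewrite [X in opA _ X](bigD1 i) //= Monoid.mulmA.
Qed.

End ProductOfTuple.

(** * Multilinearity of the composites in the Jacobi identity *)

Section MultilinearComp.
Variables (K : fieldType) (n : nat) (V W : lmodType K).
Variable f : {ffun 'I_n -> V} -> W.
Hypothesis fM : multilinear f.

Lemma multilinear_comp_upd m (U : lmodType K) (g : {ffun 'I_m -> U} -> V) x i :
  multilinear g -> multilinear (fun y => f (upd x i (g y))).
Proof. by move=> gM y j c u v; rewrite gM fM. Qed.

(** Presents the appended entry as a slot, so that multilinearity applies to it. *)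
Lemma append_last_upd (x : 'I_n.-1 -> V) : (0 < n)%N ->
  exists i : 'I_n, forall z, append_last x z = upd (append_last x 0) i z.
Proof.
case: n x => // m x _; exists ord_max => z; apply/ffunP=> j; rewrite !ffunE.
case: insubP => [k km _|]; last first.
  by rewrite -leqNgt => mj; rewrite -val_eqE eqn_leq mj -ltnS ltn_ord.
by case: eqP km => // ->; rewrite /= ltnn.
Qed.

(** Serves with [h] the twisting map for the left side of the Jacobi identity, and with [idfun] for
    the inner brackets on the right. *)
Lemma multilinear_comp_append_last (U : lmodType K) (h : {linear U -> V}) z :
  multilinear (fun x : {ffun 'I_n.-1 -> U} => f (append_last (h \o x) z)).
Proof.
move=> x i c u v; have ltin : (i < n)%N by apply: leq_trans (leq_pred n).
have E w : append_last (h \o upd x i w) z =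
    upd (append_last (h \o x) z) (Ordinal ltin) (h w).
  apply/ffunP=> j; rewrite !ffunE -val_eqE /=.
  case: insubP => [k _ <-|ji] /=; first by rewrite ffunE -val_eqE (fun_if h).
  by case: eqP ji => // ->; rewrite ltn_ord.
by rewrite !E linearP fM.
Qed.

(** The update overwrites [h (y i)], so each entry of [y] enters exactly once and linearly. *)
Lemma multilinear_comp_slot (U : lmodType K) (h : {linear U -> V}) (k : U -> V) i :
  linear k ->
  multilinear (fun y : {ffun 'I_n -> U} =>
    f (upd [ffun j => h (y j)] i (k (y i)))).
Proof.
move=> k_lin y l c u v.
have E w : [ffun j => h (upd y l w j)] = upd [ffun j => h (y j)] l (h w).
  by apply/ffunP=> j; rewrite !ffunE (fun_if h).
rewrite !E; have [->|li] := eqVneq l i.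
  by rewrite !upd_upd !upd_same k_lin fM.
by rewrite !(updC _ _ _ li) !(@upd_other _ _ _ _ l _ i) 1?eq_sym // linearP fM.
Qed.

End MultilinearComp.

(** * The color algebra structure on [tensor A L] *)

Section TensorColor.
Variables (G : zmodType) (K : fieldType) (A L : lmodType K) (Lg : G -> set L).

(** Pure tensors with second factor in [Lg g] span degree [g] by definition, so this reduces the
    axioms to such tensors. *)
Lemma eq_multilinear_tensor (n : nat) (M : lmodType K)
    (f g : {ffun 'I_n -> tensor A L} -> M) (d : 'I_n -> G) :
  multilinear f -> multilinear g ->
  (forall (a : {ffun 'I_n -> A}) (x : {ffun 'I_n -> L}),
     (forall i, Lg (d i) (x i)) ->
     f [ffun i => tens (a i) (x i)] = g [ffun i => tens (a i) (x i)]) ->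
  forall t : {ffun 'I_n -> tensor A L},
    (forall i, tensor_grading Lg (d i) (t i)) -> f t = g t.
Proof.
move=> fM gM fg t td.
apply: (@eq_multilinear_span _ _ _ _ _ _
  (fun i u => exists p : A * L, Lg (d i) p.2 /\ u = tens p.1 p.2)) => //.
  move=> x /choice[p xp].
  have -> : x = [ffun i => tens ([ffun j => (p j).1] i) ([ffun j => (p j).2] i)].
    by apply/ffunP=> i; rewrite !ffunE; case: (xp i).
  by apply: fg => i; rewrite ffunE; case: (xp i).
move=> i; have [s [sd ->]] := td i.
exists [seq tens p.1 p.2 | p <- s]; rewrite big_map; split=> //.
by move=> u /mapP[p /sd pd ->]; exists p.
Qed.

End TensorColor.

Theorem theorem3p9 (G : zmodType) (K : fieldType) (K_char : 2%N \notin [pchar K])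
  (n : nat) (n_ge2 : (2 <= n)%N)
  (A : lmodType K) (mul : {bilinear A -> A -> A})
  (mulA : associative mul) (mulC : commutative mul)
  (L : lmodType K) (Lg : G -> set L) (br : {ffun 'I_n -> L} -> L)
  (eps : G -> G -> K) (alpha : {linear L -> L})
  (L_color : is_nHomLieColor Lg br eps alpha) :
  exists (br' : {ffun 'I_n -> tensor A L} -> tensor A L)
         (alpha' : {linear tensor A L -> tensor A L}),
    [/\ forall (a : 'I_n -> A) (x : {ffun 'I_n -> L}),
          br' [ffun i => tens (a i) (x i)] = tens (nprod mul a) (br x),
        forall (a : A) (x : L), alpha' (tens a x) = tens a (alpha x) &
        is_nHomLieColor (tensor_grading (A := A) Lg) br' eps alpha'].
Proof.
have n_gt0 : (0 < n)%N by apply: ltnW.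
have [Lgr brM epsB alpha_even skew jacobi] := L_color.
have [alpha' alpha'E] := tensor_map A alpha.
have eq_nprod (a b : 'I_n -> A) : a =1 b -> nprod mul a = nprod mul b.
  by move=> ab; rewrite /nprod (eq_map ab).
(* The bracket formula, read on tuples of pairs, is bilinear in each pair because [nprod] and [br]
   are multilinear. *)
have [|br' [br'M br'P]] := @multilinear_tensor_lift _ A L n (tensor A L)
    (fun p => tens (nprod mul [ffun i => (p i).1]) (br [ffun i => (p i).2])).
  move=> p i.
  have E a x : tens (nprod mul [ffun j => (upd p i (a, x) j).1])
        (br [ffun j => (upd p i (a, x) j).2]) =
      tens (nprod mul (upd [ffun j => (p j).1] i a))
        (br (upd [ffun j => (p j).2] i x)).
    by congr (tens (nprod _ (fun_of_fin _)) (br _)); apply/ffunP=> j;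
      rewrite !ffunE; case: eqP.
  split=> [x|a] c u v /=; rewrite !E.
    by rewrite (nprod_multilinear mulA mulC) linearPl.
  by rewrite brM linearPr.
have br'E (a : 'I_n -> A) (x : {ffun 'I_n -> L}) :
    br' [ffun i => tens (a i) (x i)] = tens (nprod mul a) (br x).
  have -> : [ffun i => tens (a i) (x i)] =
      [ffun i => tens ([ffun j => (a j, x j)] i).1 ([ffun j => (a j, x j)] i).2].
    by apply/ffunP=> i; rewrite !ffunE.
  rewrite br'P; congr (tens _ (br _)); last by apply/ffunP=> i; rewrite !ffunE.
  by apply: eq_nprod => i; rewrite !ffunE.
exists br', alpha'; split=> //; split=> //.
- exact: tensor_is_grading.
- move=> g _ [s [sg ->]]; exists [seq (p.1, alpha p.2) | p <- s]; split.
    by move=> p /mapP[q qs ->]; apply/alpha_even/sg.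
  by rewrite raddf_sum big_map; apply: eq_bigr => p _; apply: alpha'E.
- move=> t d td i j ij.
  pose g (t : {ffun 'I_n -> tensor A L}) :=
    - (eps (d i) (d j) *: br' [ffun k => t (tperm i j k)]).
  have gM : multilinear g.
    exact/multilinear_opp/multilinear_scale/multilinear_perm.
  apply: (eq_multilinear_tensor br'M gM _ td) => a x xd; rewrite /g.
  have -> : [ffun k => [ffun l => tens (a l) (x l)] (tperm i j k)] =
      [ffun k => tens ((a \o tperm i j) k) ([ffun l => x (tperm i j l)] k)].
    by apply/ffunP=> k; rewrite !ffunE.
  (* Commutativity of [A] leaves the coefficient unchanged by the transposition, so the sign and
     [eps] come from [L] alone. *)
  rewrite !br'E (nprod_perm mulA mulC) // (skew x d xd i j ij).
  by rewrite linearNr linearZr_LR.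
move=> t dt y dy td yd.
(* The axiom takes a plain function here, whereas multilinearity is stated for finite functions. *)
have -> : t = [ffun i => t i] :> ('I_n.-1 -> _) by apply/funext=> i; rewrite ffunE.
have {td}: forall i, tensor_grading Lg (dt i) ([ffun i => t i] i).
  by move=> i; rewrite ffunE.
move: [ffun i => t i] => {}t.
set eX := \sum_j dt j.
(* The arity [m] stays free: it is [n.-1] for the outer arguments [t] and [n] for [y]. *)
have sumM (m : nat) (F : 'I_n -> {ffun 'I_m -> tensor A L} -> tensor A L) :
    (forall i, multilinear (F i)) ->
    multilinear (fun t => \sum_(i < n) eps eX (\sum_(j < n | (j < i)%N) dy j) *: F i t).
  by move=> FM; apply: multilinear_sum => i; apply: multilinear_scale.
pose rhs (t : 'I_n.-1 -> tensor A L) (y : {ffun 'I_n -> tensor A L}) :=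
  \sum_(i < n) eps eX (\sum_(j < n | (j < i)%N) dy j) *:
    br' (upd [ffun j => alpha' (y j)] i (br' (append_last t (y i)))).
(* The reduction to pure tensors is done twice: first in [t] with [y] fixed, then in [y] with [t]
   already pure. *)
apply: (@eq_multilinear_tensor G K A L Lg n.-1 _
  (fun t => br' (append_last (alpha' \o t) (br' y))) (rhs ^~ y) dt).
- exact: multilinear_comp_append_last.
- apply: sumM => i; apply: multilinear_comp_upd => //.
  exact: (multilinear_comp_append_last br'M idfun).
move=> a x xd; set t0 := [ffun i => tens (a i) (x i)].
have br'_last_lin v : linear (fun u => br' (append_last v u)).
  have [i iE] : exists i, forall z, append_last v z = upd (append_last v 0) i z.
    exact: append_last_upd.
  by move=> c u w; rewrite !(iE (_ + _)) (iE u) (iE w) br'M.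
apply: (@eq_multilinear_tensor G K A L Lg n _
  (fun y => br' (append_last (alpha' \o t0) (br' y))) (rhs t0) dy) yd.
- by move=> z i c u v; rewrite br'M br'_last_lin.
- apply: sumM => i.
  exact: (multilinear_comp_slot br'M alpha' i (br'_last_lin _)).
move=> {y} b y yd.
(* Used with [alpha] for the outer bracket on the left and with [id] for the inner brackets on the
   right. *)
have tens_append (h : L -> L) c z (h' : tensor A L -> tensor A L) :
    (forall c z, h' (tens c z) = tens c (h z)) ->
    append_last (h' \o t0) (tens c z) =
    [ffun i => tens (append_last a c i) (append_last (h \o x) z i)].
  move=> hE; apply/ffunP=> i; rewrite !ffunE.
  by case: insub => // j; rewrite /= ffunE hE.
rewrite !br'E (tens_append alpha) // br'E (jacobi x dt y dy) // linear_sumr.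
apply: eq_bigr => i _; rewrite linearZr_LR; congr (_ *: _).
rewrite ffunE (tens_append id _ _ id) // br'E.
rewrite (nprod_jacobi mulA mulC a b i) -[LHS]br'E; congr br'.
by apply/ffunP=> j; rewrite !ffunE; case: eqP => // _; rewrite alpha'E.
Qed.
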